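(* Every X-tree has a $5$-track layout.
   Context: For an integer $D\ge 0$, the X-tree of depth $D$ is obtained from the complete binary tree of depth $D$ (levels $0,\dots,D$, level $d$ containing $2^d$ vertices) by adding, for each level $d$ with vertices $v_1,\dots,v_{2^d}$ listed in the left-to-right order of the tree, the edges $(v_i,v_{i+1})$ for $1\le i<2^d$. A $t$-track assignment of a graph $G$ is a partition of $V(G)$ into $t$ sets $V_1,\dots,V_t$ (tracks), each an independent set of $G$, together with a total order $<_i$ on each $V_i$. An X-crossing consists of two edges $(u,v)$ and $(x,y)$ with $u,x\in V_i$, $v,y\in V_j$ ($i\neq j$), $u<_i x$ and $y<_j v$. A $t$-track layout is a $t$-track assignment with no X-crossing. *)

(* Defs.v *)
From mathcomp Require Import all_boot.
Set Implicit Arguments. Unset Strict Implicit. Unset Printing Implicit Defensive.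

(* Vertices of the X-tree of depth D: pairs (d, i) with d <= D (level) and
   i < 2^d (position in the left-to-right order of level d). The children of
   (d, i) are (d+1, 2i) and (d+1, 2i+1). *)
Definition xvalid (D : nat) (p : nat * nat) : bool := (p.1 <= D) && (p.2 < 2 ^ p.1).

Definition xvert (D : nat) := {p : nat * nat | xvalid D p}.

Definition tree_edge (p q : nat * nat) : bool :=
  (q.1 == p.1.+1) && ((q.2 == p.2.*2) || (q.2 == p.2.*2.+1)).

Definition level_edge (p q : nat * nat) : bool :=
  (q.1 == p.1) && (q.2 == p.2.+1).

Definition xadj (p q : nat * nat) : bool :=
  [|| tree_edge p q, tree_edge q p, level_edge p q | level_edge q p].

Definition xedge (D : nat) (u v : xvert D) : bool := xadj (val u) (val v).

Definition track_layout (V : Type) (E : V -> V -> bool) (t : nat)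
  (trk : V -> 'I_t) (ord : 'I_t -> V -> V -> Prop) : Prop :=
  (forall u v, E u v -> trk u <> trk v) /\
  (forall i u, trk u = i -> ~ ord i u u) /\
  (forall i u v w, trk u = i -> trk v = i -> trk w = i ->
      ord i u v -> ord i v w -> ord i u w) /\
  (forall i u v, trk u = i -> trk v = i -> u <> v -> ord i u v \/ ord i v u) /\
  (forall u v x y, E u v -> E x y ->
      trk u = trk x -> trk v = trk y -> trk u <> trk v ->
      ord (trk u) u x -> ord (trk v) y v -> False).

(* Main.v *)
(* Assign to every vertex a rank that increases by 1 or 2 from a parent to each
   of its children and differs by exactly 1 between neighbours on a level:
   depth plus the number of ones in the Gray code of the position. View a vertex
   as a dyadic interval. Vertices of equal rank are never ancestor-related, so
   their intervals are disjoint and can be ordered from left to right. An edge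
   joins an interval to one of its halves or to an adjacent interval of the same
   length, and two edges between the same two ranks never cross: in the only
   critical case both edges join adjacent intervals meeting at a common point,
   and comparing ranks makes each pair of intervals strictly longer than the
   other. Since the ranks of adjacent vertices differ by at most 2, taking ranks
   modulo 5 and ordering each track first by rank creates no X-crossing. *)
Require Import Defs.
From mathcomp Require Import all_boot.
From mathcomp Require Import zify.
Set Implicit Arguments. Unset Strict Implicit. Unset Printing Implicit Defensive.

Fixpoint rank (d i : nat) : nat :=
  if d is d'.+1 then (rank d' i./2 + (odd i (+) odd i./2)).+1 else 0.

Definition vrank (p : nat * nat) : nat := rank p.1 p.2.

Lemma rank_child d i (b : bool) :
  rank d.+1 (b + i.*2) = (rank d i + (b (+) odd i)).+1.
Proof. by rewrite /= half_bit_double oddD odd_double addbF; case: b. Qed.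

Lemma rank_level d i : i.+1 < 2 ^ d ->
  rank d i.+1 = (rank d i).+1 \/ rank d i = (rank d i.+1).+1.
Proof.
elim: d i => [|d IHd] i; first by rewrite expn0.
rewrite -(odd_double_half i); set k := i./2.
case: (odd i) => hi.
(* Different parents: the last bit and the parity of the parent both flip, so the two increments
   agree and the difference is inherited. *)
- have hk : k.+1 < 2 ^ d by move: hi; rewrite expnS; lia.
  have -> : (true + k.*2).+1 = false + k.+1.*2 by lia.
  rewrite !rank_child /=.
  by case: (IHd k hk); case: (odd k) => /=; lia.
- have -> : (false + k.*2).+1 = true + k.*2 by lia.
  by rewrite !rank_child; case: (odd k) => /=; lia.
Qed.

Lemma rank_half_iter d k i : k + rank d (i %/ 2 ^ k) <= rank (k + d) i.
Proof.
elim: k i => [|k IHk] i; first by rewrite divn1.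
rewrite addSn expnS divnMA divn2 /=.
by have := IHk i./2; lia.
Qed.

(* The vertex (d, i) stands for the interval [i 2^-d, (i+1) 2^-d], scaled by 2^D
   so that its endpoints [lo] and [hi] are natural numbers. *)
Definition lo (D : nat) (p : nat * nat) : nat := p.2 * 2 ^ (D - p.1).
Definition hi (D : nat) (p : nat * nat) : nat := p.2.+1 * 2 ^ (D - p.1).

Lemma hiE D p : hi D p = lo D p + 2 ^ (D - p.1).
Proof. by rewrite /hi /lo mulSn addnC. Qed.

Lemma lo_lt_hi D p : lo D p < hi D p.
Proof. by rewrite hiE -addn1 leq_add2l expn_gt0. Qed.

Lemma dyadic_disjoint_or_nested D p q : p.1 <= q.1 -> q.1 <= D ->
  [\/ hi D p <= lo D q, hi D q <= lo D p |
      [/\ lo D p <= lo D q, hi D q <= hi D p, vrank p + (q.1 - p.1) <= vrank q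
        & p.1 = q.1 -> p = q]].
Proof.
case: p q => [d i] [e j] /= de eD.
set k := e - d; have De : D - d = k + (D - e) by lia.
rewrite /hi /lo /vrank /= De expnD !mulnA.
(* [j %/ 2 ^ k] is the position of the ancestor of [(e, j)] on level [d]. *)
case: (ltngtP (j %/ 2 ^ k) i) => hji.
- constructor 2; rewrite leq_pmul2r ?expn_gt0 //.
  by rewrite ltn_divLR ?expn_gt0 in hji.
- constructor 1; rewrite leq_pmul2r ?expn_gt0 //.
  by rewrite -leq_divRL ?expn_gt0.
- constructor 3; rewrite !leq_pmul2r ?expn_gt0 //; split.
  + by rewrite -hji leq_divM.
  + by rewrite -hji ltn_ceil ?expn_gt0.
  + have := rank_half_iter d k j; rewrite hji.
    have -> : k + d = e by lia.
    by rewrite addnC.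
  + move=> ede; rewrite /k ede subnn expn0 divn1 in hji.
    by rewrite hji ede.
Qed.

(** Each level of nesting raises the rank by at least 1, so nested intervals of equal rank lie on
    one level and coincide. *)
Lemma same_rank_disjoint D p q : p.1 <= D -> q.1 <= D -> vrank p = vrank q ->
  [\/ hi D p <= lo D q, hi D q <= lo D p | p = q].
Proof.
wlog pq : p q / p.1 <= q.1 => [hw pD qD r|].
  case: (leqP p.1 q.1) => [|/ltnW] pq; first exact: hw.
  by case: (hw q p pq qD pD (esym r)) => ?;
    [constructor 2|constructor 1|constructor 3].
move=> _ qD r; case: (dyadic_disjoint_or_nested pq qD) => [h|h|[_ _ h1 h2]].
- by constructor 1.
- by constructor 2.
- by constructor 3; apply: h2; lia.
Qed.

(** Of two nested intervals the larger has the smaller rank, so only [p] can be the strict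
    ancestor. *)
Lemma lt_rank_disjoint_or_nested D p q : p.1 <= D -> q.1 <= D ->
  vrank p < vrank q ->
  [\/ hi D p <= lo D q, hi D q <= lo D p | hi D q - lo D q < hi D p - lo D p].
Proof.
move=> pD qD r; case: (leqP p.1 q.1) => pq.
- case: (dyadic_disjoint_or_nested pq qD) => [h|h|[_ _ _ h]].
  + by constructor 1.
  + by constructor 2.
  + constructor 3; rewrite !hiE !addKn ltn_exp2l //.
    have [e|] := eqVneq p.1 q.1; last by lia.
    by move: r; rewrite (h e) ltnn.
- case: (dyadic_disjoint_or_nested (ltnW pq) pD) => [h|h|[_ _ h _]].
  + by constructor 2.
  + by constructor 1.
  + lia.
Qed.

Lemma tree_edge_rank p q : tree_edge p q ->
  vrank p < vrank q <= vrank p + 2.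
Proof.
case: p q => [d i] [e j] /= /andP[/= /eqP -> /orP[] /eqP ->]; rewrite /vrank.
- by rewrite -[i.*2]/(false + i.*2) rank_child /=; case: (odd i); lia.
- by rewrite -[i.*2.+1]/(true + i.*2) rank_child /=; case: (odd i); lia.
Qed.

Lemma tree_edge_nested D p q : q.1 <= D -> tree_edge p q ->
  lo D p <= lo D q /\ hi D q <= hi D p.
Proof.
case: p q => [d i] [e j] /= eD /andP[/= /eqP ee hj]; rewrite /lo /hi /=.
have -> : D - d = (D - e).+1 by lia.
by rewrite expnS; case/orP: hj => /eqP ->; lia.
Qed.

Lemma level_edge_adjacent D p q : level_edge p q ->
  hi D p = lo D q /\ hi D p - lo D p = hi D q - lo D q.
Proof.
case: p q => [d i] [e j] /= /andP[/= /eqP -> /eqP ->].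
by rewrite !hiE !addKn /lo /= mulSn addnC.
Qed.

Lemma xadj_sym p q : xadj p q = xadj q p.
Proof. by rewrite /xadj orbCA (orbC (level_edge p q)). Qed.

Lemma level_edge_rank D p q : xvalid D q -> level_edge p q ->
  vrank q = (vrank p).+1 \/ vrank p = (vrank q).+1.
Proof.
case: p q => [d i] [e j] /andP[/= _ qv] /andP[/= /eqP ee /eqP jj]; subst e j.
exact: rank_level.
Qed.

Lemma xadj_rank D p q : xvalid D p -> xvalid D q -> xadj p q ->
  vrank p < vrank q <= vrank p + 2 \/ vrank q < vrank p <= vrank q + 2.
Proof.
move=> pv qv /or4P[] h.
- by left; apply: tree_edge_rank.
- by right; apply: tree_edge_rank.
- by case: (level_edge_rank qv h); lia.
- by case: (level_edge_rank pv h); lia.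
Qed.

Lemma xadj_intervals D p q : xvalid D p -> xvalid D q -> xadj p q ->
  vrank p < vrank q ->
  (lo D p <= lo D q /\ hi D q <= hi D p) \/
  ((hi D p = lo D q \/ hi D q = lo D p) /\
   hi D p - lo D p = hi D q - lo D q).
Proof.
move=> /andP[pD _] /andP[qD _] /or4P[] h r.
- by left; apply: tree_edge_nested.
- by have := tree_edge_rank h; lia.
- by right; have := level_edge_adjacent D h; lia.
- by right; have := level_edge_adjacent D h; lia.
Qed.

Lemma same_rank_noncrossing D u v x y :
  xvalid D u -> xvalid D v -> xvalid D x -> xvalid D y ->
  xadj u v -> xadj x y -> vrank u = vrank x -> vrank v = vrank y ->
  vrank u < vrank v -> hi D u <= lo D x -> hi D y <= lo D v -> False.
Proof.
move=> uV vV xV yV uv xy rux rvy ruv ux yv.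
have := xadj_intervals uV vV uv ruv.
have rxy : vrank x < vrank y by rewrite -rux -rvy.
have := xadj_intervals xV yV xy rxy.
have [/andP[uD _] /andP[vD _]] := (uV, vV).
have [/andP[xD _] /andP[yD _]] := (xV, yV).
(* If all four intervals share an endpoint, [u] and [y] end there while [x] and [v] begin there.
   Writing |p| for length, these ranks force |y| < |u| and |v| < |x|, against |u| = |v| and |x| =
   |y|. *)
have rxv : vrank x < vrank v by rewrite -rux.
have ruy : vrank u < vrank y by rewrite -rvy.
have := lt_rank_disjoint_or_nested xD vD rxv.
have := lt_rank_disjoint_or_nested uD yD ruy.
have := (lo_lt_hi D u, lo_lt_hi D v, lo_lt_hi D x, lo_lt_hi D y).
by move=> [[[? ?] ?] ?] [?|?|?] [?|?|?]; lia.
Qed.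

Definition track (D : nat) (u : xvert D) : 'I_5 := inord (vrank (val u) %% 5).

Definition track_lt (D : nat) (u v : xvert D) : Prop :=
  vrank (val u) < vrank (val v) \/
  (vrank (val u) = vrank (val v) /\ hi D (val u) <= lo D (val v)).

Lemma track_mod D (u v : xvert D) :
  track u = track v <-> vrank (val u) = vrank (val v) %[mod 5].
Proof.
split=> [/(congr1 val)|h]; last by rewrite /track h.
by rewrite /track /= !inordK // ltn_mod.
Qed.

Theorem theorem11 (D : nat) :
  exists (trk : xvert D -> 'I_5) (ord : 'I_5 -> xvert D -> xvert D -> Prop),
    track_layout (@xedge D) trk ord.
Proof.
exists (@track D), (fun _ => @track_lt D); rewrite /track_lt.
split; [|split; [|split; [|split]]].
- move=> u v uv /track_mod.
  by have := xadj_rank (valP u) (valP v) uv; lia.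
- by move=> _ u _; have := lo_lt_hi D (val u); lia.
- by move=> _ u v w _ _ _; have := lo_lt_hi D (val v); lia.
- move=> i u v _ _ neq.
  case: (ltngtP (vrank (val u)) (vrank (val v))) => r; [by left; left|by right; left|].
  have /andP[uD _] := valP u; have /andP[vD _] := valP v.
  case: (same_rank_disjoint uD vD r) => [h|h|/val_inj //].
  + by left; right.
  + by right; right.
- move=> u v x y uv xy /track_mod tux /track_mod tvy _ oux oyv.
  have ruv := xadj_rank (valP u) (valP v) uv.
  have rxy := xadj_rank (valP x) (valP y) xy.
  (* Both rank differences along the edges lie in {-2, -1, 1, 2} and agree modulo 5, so they are
     equal. Then [x] exceeds [u] in rank by as much as [y] exceeds [v]; the two track orders make
     this shift both nonnegative and nonpositive. *)
  have [rux rvy] :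
    vrank (val u) = vrank (val x) /\ vrank (val v) = vrank (val y) by lia.
  have [lux lyv] :
    hi D (val u) <= lo D (val x) /\ hi D (val y) <= lo D (val v) by lia.
  case: (ltngtP (vrank (val u)) (vrank (val v))) => r; last by lia.
  + exact: (same_rank_noncrossing (valP u) (valP v) (valP x) (valP y)).
  (* Reading the crossing from the other track, [y] and [v] become the ends of smaller rank. *)
  + have ryx : vrank (val y) < vrank (val x) by lia.
    apply: (same_rank_noncrossing (valP y) (valP x) (valP v) (valP u)
      _ _ (esym rvy) (esym rux) ryx lyv lux); by rewrite xadj_sym.
Qed.
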